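(* The eigenvalues of $\mathcal A_1=\mathbf L^T\mathbf D^{-1}\mathbf L+\mathbf H^T\mathbf R^{-1}\mathbf H$ lie in the interval $$I_+=\left[\frac{\theta_{min}^2}{\tau_{max}},\ \frac{\theta_{max}^2}{\tau_{min}}\right].$$
   Context: Let $N,n\ge 1$ be integers, $m=(N+1)n$, $p_0,\dots,p_N\ge 0$ integers with $p=\sum_{i=0}^N p_i\ge 1$. Let $B,Q_1,\dots,Q_N\in\mathbb R^{n\times n}$ and $R_i\in\mathbb R^{p_i\times p_i}$ ($0\le i\le N$) be symmetric positive definite, and let $M_0,\dots,M_{N-1}\in\mathbb R^{n\times n}$, $H_i\in\mathbb R^{p_i\times n}$ ($0\le i\le N$) be arbitrary. Define the block diagonal matrices $\mathbf D=\mathrm{diag}(B,Q_1,\dots,Q_N)\in\mathbb R^{m\times m}$, $\mathbf R=\mathrm{diag}(R_0,\dots,R_N)\in\mathbb R^{p\times p}$, $\mathbf H=\mathrm{diag}(H_0,\dots,H_N)\in\mathbb R^{p\times m}$, and let $\mathbf L\in\mathbb R^{m\times m}$ be the block lower bidiagonal matrix with $n\times n$ identity blocks on the diagonal and blocks $-M_0,\dots,-M_{N-1}$ on the first block subdiagonal (all other blocks zero). Notation: $\psi_{min},\psi_{max}$ are the smallest and largest eigenvalues of $\mathbf D$; $\rho_{min},\rho_{max}$ those of $\mathbf R$; $\tau_{min}=\min\{\psi_{min},\rho_{min}\}$, $\tau_{max}=\max\{\psi_{max},\rho_{max}\}$; $\theta_{min}$ and $\theta_{max}$ are the smallest nonzero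 and the largest singular values of $(\mathbf L^T\ \ \mathbf H^T)\in\mathbb R^{m\times(m+p)}$. *)

(* Defs.v *)
From HB Require Import structures.
From mathcomp Require Import all_boot all_order all_algebra.
From mathcomp Require Import reals.
From mathcomp.real_closed Require Import polyrcf.

Set Implicit Arguments.
Unset Strict Implicit.
Unset Printing Implicit Defensive.
Import Order.TTheory GRing.Theory Num.Theory.
Local Open Scope ring_scope.

Definition symmetric_posdef (R : realType) (n : nat) (A : 'M[R]_n) : Prop :=
  A^T = A /\ forall x : 'cV[R]_n, x != 0 -> 0 < (x^T *m A *m x) 0 0.

(* The extremal elements of a nonempty sequence; junk value 0 on [::]. *)
Definition seq_min (R : realType) (s : seq R) : R :=
  \big[Num.min/head 0 s]_(x <- s) x.
Definition seq_max (R : realType) (s : seq R) : R :=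
  \big[Num.max/head 0 s]_(x <- s) x.

(* The real eigenvalues, without multiplicity. *)
Definition eigenvalues (R : realType) (n : nat) (A : 'M[R]_n) : seq R :=
  rootsR (char_poly A).

Definition eig_min (R : realType) (n : nat) (A : 'M[R]_n) : R :=
  seq_min (eigenvalues A).
Definition eig_max (R : realType) (n : nat) (A : 'M[R]_n) : R :=
  seq_max (eigenvalues A).

(* The Gram matrix of smaller size has exactly the squares of the min(k, l)
   singular values as eigenvalues; the larger one may add a spurious zero. *)
Definition singular_values (R : realType) (k l : nat) (A : 'M[R]_(k, l)) :
    seq R :=
  [seq Num.sqrt a | a <- if (k <= l)%N then eigenvalues (A *m A^T)
                         else eigenvalues (A^T *m A)].

Definition sv_min_nonzero (R : realType) (k l : nat) (A : 'M[R]_(k, l)) : R :=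
  seq_min [seq s <- singular_values A | s != 0].
Definition sv_max (R : realType) (k l : nat) (A : 'M[R]_(k, l)) : R :=
  seq_max (singular_values A).

(* Block families indexed by 1, ..., N (the Q's) or 0, ..., N-1 (the M's) are
   indexed by 'I_N.  For a block index i : 'I_N.+1, unlift ord0 i is None if
   i = 0 and Some k with k = i - 1 otherwise, so Q k stands for Q_{k+1}. *)
Definition block_D (R : realType) (N n : nat) (B : 'M[R]_n)
    (Q : 'I_N -> 'M[R]_n) : 'M[R]_(\sum_(i < N.+1) n) :=
  \mxdiag_(i < N.+1) (if unlift ord0 i is Some k then Q k else B).

Definition block_L (R : realType) (N n : nat) (M : 'I_N -> 'M[R]_n) :
    'M[R]_(\sum_(i < N.+1) n) :=
  \mxblock_(i < N.+1, j < N.+1)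
    (if i == j then 1%:M
     else if unlift ord0 i is Some k then
       if k == j :> nat then - M k else 0
     else 0).

Definition block_R (R : realType) (N : nat) (p : 'I_N.+1 -> nat)
    (Rb : forall i, 'M[R]_(p i)) : 'M[R]_(\sum_(i < N.+1) p i) :=
  \mxdiag_(i < N.+1) Rb i.

(* mxdiag only covers square blocks. *)
Definition block_H (R : realType) (N n : nat) (p : 'I_N.+1 -> nat)
    (H : forall i, 'M[R]_(p i, n)) :
    'M[R]_(\sum_(i < N.+1) p i, \sum_(i < N.+1) n) :=
  \mxblock_(i < N.+1, j < N.+1) (if i == j then H i else 0).

(* Main.v *)
(* If v is an eigenvector of A1 for lambda and G = (L^T H^T), then
     lambda |v|^2 = (vL^T) D^-1 (vL^T)^T + (vH^T) R^-1 (vH^T)^T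
   lies between |vG|^2 / tau_max and |vG|^2 / tau_min by Rayleigh's bounds for
   D^-1 and R^-1, while Rayleigh's bounds for G G^T put |vG|^2 = v G G^T v^T
   between theta_min^2 |v|^2 and theta_max^2 |v|^2.  As L is unit lower
   triangular, G G^T is positive definite, so that all singular values of G are
   nonzero and theta_min is the smallest one. *)
Require Import Defs.
From HB Require Import structures.
From mathcomp Require Import all_boot all_order all_algebra.
From mathcomp Require Import reals.
From mathcomp.real_closed Require Import polyrcf complex.

Set Implicit Arguments.
Unset Strict Implicit.
Unset Printing Implicit Defensive.
Import Order.TTheory GRing.Theory Num.Theory.
Local Open Scope ring_scope.

(** * Rayleigh bounds for real symmetric matrices *)

Lemma dotself_sum (R : rcfType) n (v : 'rV[R]_n) :
  (v *m v^T) 0 0 = \sum_i v 0 i ^+ 2.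
Proof. by rewrite mxE; apply: eq_bigr => i _; rewrite mxE expr2. Qed.

Lemma dotself_ge0 (R : rcfType) n (v : 'rV[R]_n) : 0 <= (v *m v^T) 0 0.
Proof. by rewrite dotself_sum sumr_ge0 // => i _; rewrite sqr_ge0. Qed.

Lemma dotself_gt0 (R : rcfType) n (v : 'rV[R]_n) :
  v != 0 -> 0 < (v *m v^T) 0 0.
Proof.
move=> v0; rewrite lt_def dotself_ge0 andbT dotself_sum.
apply: contra v0; rewrite psumr_eq0 => [/allP h|i _]; last exact: sqr_ge0.
apply/eqP/rowP => i; apply/eqP; rewrite mxE -sqrf_eq0.
exact: h (mem_index_enum i).
Qed.

Local Open Scope sesquilinear_scope.

(* The spectral theorem is only available over a closed field, so the real
   symmetric matrix is diagonalized as a Hermitian matrix over R[i]. *)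
Lemma sym_form_ge (R : rcfType) n (A : 'M[R]_n) (c : R) (v : 'rV[R]_n) :
  A^T = A -> (forall a, eigenvalue A a -> c <= a) ->
  c * (v *m v^T) 0 0 <= (v *m A *m v^T) 0 0.
Proof.
move=> symA Age; pose f := real_complex R.
have fconj m k (B : 'M[R]_(m, k)) : map_mx Num.conj (map_mx f B) = map_mx f B.
  by apply/matrixP => i j; rewrite !mxE; apply: conjc_real.
pose Af := map_mx f A; pose d := spectral_diag Af; pose P := spectralmx Af.
have Aherm : Af \is hermsymmx.
  apply/is_hermitianmxP; rewrite expr0 scale1r.
  by rewrite map_trmx symA fconj.
have Punit : P \is unitarymx := spectral_unitarymx Af.
have PPt : P *m P^t* = 1%:M by apply/unitarymxP.
have Adec : Af = P^t* *m diag_mx d *m P.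
  by rewrite -invmx_unitary //; apply/orthomx_spectralP/hermitian_normalmx.
(* Since [Af] is Hermitian, [d 0 i] is real. It is an eigenvalue of [Af] with row i of [P] as left
   eigenvector, and [f] reflects eigenvalues, so [Age] applies. *)
have dge i : f c <= d 0 i.
  have /mxOverP/(_ 0 i)/complex_realP[a da] := hermitian_spectral_diag_real Aherm.
  rewrite da lecR; apply: Age; rewrite -(eigenvalue_map f).
  apply/eigenvalueP; exists (row i P).
    rewrite -row_mul [X in row i (P *m X)]Adec !mulmxA PPt mul1mx.
    by rewrite row_mul row_diag_mx -scalemxAl -rowE da.
  apply/negP => /eqP Pi0; have /(congr1 (row i)) := PPt.
  rewrite row_mul Pi0 mul0mx => /rowP/(_ i); rewrite !mxE eqxx => /esym/eqP.
  by rewrite oner_eq0.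
(* [w] holds the coordinates of [v] in the orthonormal eigenbasis; both forms become sums of the
   [|w_i|^2], weighted by [d] or by 1. *)
pose w := map_mx f v *m P^t*.
have wt : P *m map_mx f v^T = w^t*.
  by rewrite /w trmx_mul map_mxM trmxCK map_trmx fconj.
have formA : f ((v *m A *m v^T) 0 0) = \sum_i d 0 i * `|w 0 i| ^+ 2.
  transitivity ((w *m diag_mx d *m w^t*) 0 0).
    have -> : w *m diag_mx d *m w^t* = map_mx f (v *m A *m v^T).
      by rewrite -wt !map_mxM -/Af Adec /w !mulmxA.
    by rewrite [RHS]mxE.
  rewrite mxE; apply: eq_bigr => i _.
  by rewrite mul_mx_diag !mxE normCK mulrAC mulrA mulrC mulrA.
have form1 : f ((v *m v^T) 0 0) = \sum_i `|w 0 i| ^+ 2.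
  transitivity ((w *m w^t*) 0 0).
    have -> : w *m w^t* = map_mx f (v *m v^T).
      rewrite -wt /w mulmxA -[_ *m _ *m P]mulmxA.
      by rewrite (mulmx1C PPt) mulmx1 map_mxM.
    by rewrite [RHS]mxE.
  by rewrite mxE; apply: eq_bigr => i _; rewrite !mxE normCK.
suff: f (c * (v *m v^T) 0 0) <= f ((v *m A *m v^T) 0 0) by rewrite lecR.
have -> : f (c * (v *m v^T) 0 0) = f c * f ((v *m v^T) 0 0) by apply: rmorphM.
rewrite form1 formA mulr_sumr ler_sum // => i _.
by rewrite ler_wpM2r ?exprn_ge0.
Qed.

Local Close Scope sesquilinear_scope.

(** The lower bound is applied to [- A], whose eigenvalues are the opposites. *)
Lemma sym_form_le (R : rcfType) n (A : 'M[R]_n) (c : R) (v : 'rV[R]_n) :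
  A^T = A -> (forall a, eigenvalue A a -> a <= c) ->
  (v *m A *m v^T) 0 0 <= c * (v *m v^T) 0 0.
Proof.
move=> symA Ale; rewrite -lerN2 -mulNr.
have -> : - (v *m A *m v^T) 0 0 = (v *m (- A) *m v^T) 0 0.
  by rewrite mulmxN mulNmx [RHS]mxE.
apply: sym_form_ge => [|a /eigenvalueP[u uA u0]]; first by rewrite linearN /= symA.
rewrite lerNl; apply: Ale; apply/eigenvalueP; exists u => //.
by rewrite scaleNr -uA mulmxN opprK.
Qed.

(** * Eigenvalues of symmetric, inverse and block diagonal matrices *)

Lemma eigenvaluesP (R : realType) n (A : 'M[R]_n) a :
  eigenvalue A a = (a \in eigenvalues A).
Proof.
rewrite eigenvalue_root_char /eigenvalues -roots_on_rootsR ?in_itv //.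
(* The roots are listed completely only for a nonzero polynomial. *)
by rewrite monic_neq0 ?char_poly_monic.
Qed.

Lemma sym_eigenvalues_neq0 (R : realType) n (A : 'M[R]_n) :
  A^T = A -> (0 < n)%N -> eigenvalues A != [::].
Proof.
move=> symA n0; apply/eqP => noeig.
(* Without eigenvalues, sym_form_ge would hold for every bound. *)
pose v : 'rV[R]_n := const_mx 1.
have v0 : v != 0.
  by apply/eqP => /rowP/(_ (Ordinal n0))/eqP; rewrite !mxE oner_eq0.
have vv := dotself_gt0 v0.
(* The bound is chosen so that its product with [|v|^2] exceeds the form at [v] by 1. *)
have := @sym_form_ge _ _ A (((v *m A *m v^T) 0 0 + 1) / (v *m v^T) 0 0) v symA.
rewrite mulfVK ?gt_eqF // gerDl ler10 => /(_ _)/notF[] // a.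
by rewrite eigenvaluesP noeig.
Qed.

Lemma eigenvalue_invmx (F : fieldType) n (A : 'M[F]_n) a :
  A \in unitmx -> eigenvalue (invmx A) a -> eigenvalue A a^-1.
Proof.
move=> Aunit /eigenvalueP[v vA v0]; apply/eigenvalueP; exists v => //.
have vE : v = a *: (v *m A) by rewrite scalemxAl -vA mulmxKV.
have a0 : a != 0 by apply: contra v0 => /eqP a0; rewrite vE a0 scale0r.
by rewrite {2}vE scalerA mulVf // scale1r.
Qed.

Lemma eigenvalue_posdef_gt0 (R : realType) n (A : 'M[R]_n) a :
  symmetric_posdef A -> eigenvalue A a -> 0 < a.
Proof.
move=> [_ Apos] /eigenvalueP[v vA v0].
have vT0 : v^T != 0 by rewrite trmx_eq0.
have := Apos _ vT0; rewrite trmxK vA -scalemxAl mxE pmulr_lgt0 //.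
exact: dotself_gt0.
Qed.

(** Some block of an eigenvector is nonzero, and it is an eigenvector of the matching diagonal
    block; blocks of size 0 are never picked. *)
Lemma eigenvalue_mxdiag (F : fieldType) m (p : 'I_m -> nat)
    (D : forall i, 'M[F]_(p i)) a :
  eigenvalue (\mxdiag_i D i) a -> exists i, eigenvalue (D i) a.
Proof.
move=> /eigenvalueP[v vD v0].
have [i vi0] : exists i, submxrow v i != 0.
  apply/existsP; apply: contraR v0; rewrite negb_exists => /forallP h.
  apply/eqP/mxrowP => i; rewrite submxrow0; apply/eqP.
  by have := h i; rewrite negbK.
exists i; apply/eigenvalueP; exists (submxrow v i) => //.
move: vD; rewrite -{1}[v]submxrowK mul_mxrow_mxdiag => /mxrowP/(_ i).
by rewrite mxrowK => ->; apply/matrixP => k l; rewrite !mxE.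
Qed.

(** * Extremal eigenvalues and singular values *)

Lemma seq_min_le (R : realType) (s : seq R) x : x \in s -> seq_min s <= x.
Proof.
(* The default value depends on [s], so it is generalized before the induction. *)
rewrite /seq_min; elim: s (head 0 s) => // y s IHs x0.
rewrite inE big_cons ge_min => /orP[/eqP->|xs]; first by rewrite lexx.
by rewrite IHs ?orbT.
Qed.

Lemma seq_max_ge (R : realType) (s : seq R) x : x \in s -> x <= seq_max s.
Proof.
rewrite /seq_max; elim: s (head 0 s) => // y s IHs x0.
rewrite inE big_cons le_max => /orP[/eqP->|xs]; first by rewrite lexx.
by rewrite IHs ?orbT.
Qed.

Lemma seq_min_mem (R : realType) (s : seq R) : s != [::] -> seq_min s \in s.
Proof.
have mem (x0 : R) t : \big[Num.min/x0]_(x <- t) x \in x0 :: t.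
  elim: t => [|y t]; first by rewrite big_nil mem_head.
  rewrite big_cons !inE; case: leP => _; first by rewrite eqxx orbT.
  by case/orP=> ->; rewrite ?orbT.
(* The default is the head of the list, hence itself a member. *)
case: s => // y s _; rewrite /seq_min; have := mem y (y :: s).
by rewrite !inE orbA orbb.
Qed.

Lemma eig_min_gt0 (R : realType) n (A : 'M[R]_n) :
  A^T = A -> (0 < n)%N -> (forall a, eigenvalue A a -> 0 < a) -> 0 < eig_min A.
Proof.
move=> symA n0 Apos; apply: Apos.
by rewrite eigenvaluesP seq_min_mem ?sym_eigenvalues_neq0.
Qed.

Lemma sv_min_nonzero_sqr_le (R : realType) k l (A : 'M[R]_(k, l)) a :
  (k <= l)%N -> eigenvalue (A *m A^T) a -> 0 < a -> sv_min_nonzero A ^+ 2 <= a.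
Proof.
move=> kl eiga a0; rewrite /sv_min_nonzero; set s := [seq _ <- _ | _].
have as_ : Num.sqrt a \in s.
  rewrite mem_filter gt_eqF ?sqrtr_gt0 //= /singular_values kl.
  by apply: map_f; rewrite -eigenvaluesP.
(* Squaring preserves order between nonnegative numbers; the minimum is attained, so it is a square
   root. *)
have s0 : 0 <= seq_min s.
  have : seq_min s \in s by apply: seq_min_mem; case: s as_.
  by rewrite mem_filter => /andP[_ /mapP[b _ ->]]; rewrite sqrtr_ge0.
by rewrite -(sqr_sqrtr (ltW a0)) ler_pXn2r ?nnegrE ?sqrtr_ge0 // seq_min_le.
Qed.

Lemma sv_max_sqr_ge (R : realType) k l (A : 'M[R]_(k, l)) a :
  (k <= l)%N -> eigenvalue (A *m A^T) a -> 0 <= a -> a <= sv_max A ^+ 2.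
Proof.
move=> kl eiga a0; rewrite /sv_max; set s := singular_values A.
have le_s : Num.sqrt a <= seq_max s.
  by apply: seq_max_ge; rewrite /s /singular_values kl map_f // -eigenvaluesP.
have s0 := le_trans (sqrtr_ge0 a) le_s.
by rewrite -{1}(sqr_sqrtr a0) ler_pXn2r ?nnegrE ?sqrtr_ge0.
Qed.

(** * Forms of inverse matrices and invertibility of [block_L] *)

Lemma unitmx_eigenvalue (F : fieldType) n (A : 'M[F]_n) :
  ~~ eigenvalue A 0 -> A \in unitmx.
Proof.
by rewrite negbK /eigenspace raddf0 subr0 kermx_eq0 row_free_unit.
Qed.

(** The eigenvalues of the inverse are reciprocals of those of [A]. Free bounds [tmin] and [tmax]
    let D and R share the same constants. *)
Lemma invmx_form_bounds (R : realType) n (A : 'M[R]_n) (tmin tmax : R)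
    (v : 'rV[R]_n) :
  A^T = A -> (forall a, eigenvalue A a -> 0 < a) ->
  0 < tmin -> tmin <= eig_min A -> eig_max A <= tmax ->
  tmax^-1 * (v *m v^T) 0 0 <= (v *m invmx A *m v^T) 0 0
    <= tmin^-1 * (v *m v^T) 0 0.
Proof.
move=> symA Apos tmin0 tminA tmaxA.
have Aunit : A \in unitmx.
  by apply: unitmx_eigenvalue; apply/negP => /Apos; rewrite ltxx.
have symV : (invmx A)^T = invmx A by rewrite trmx_inv symA.
apply/andP; split.
  apply: sym_form_ge => // a /(eigenvalue_invmx Aunit) eigV.
  have aV0 := Apos _ eigV; rewrite -[a]invrK lef_pV2 ?posrE //.
    by apply: le_trans tmaxA; apply: seq_max_ge; rewrite -eigenvaluesP.
  (* [tmax] is positive because it dominates the positive eigenvalue [a^-1] of [A]. *)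
  apply: lt_le_trans aV0 _.
  by apply: le_trans tmaxA; apply: seq_max_ge; rewrite -eigenvaluesP.
apply: sym_form_le => // a /(eigenvalue_invmx Aunit) eigV.
have aV0 := Apos _ eigV; rewrite -[a]invrK lef_pV2 ?posrE //.
by apply: (le_trans tminA); apply: seq_min_le; rewrite -eigenvaluesP.
Qed.

Lemma sym_mxdiag (R : pzSemiRingType) m (p : 'I_m -> nat)
    (D : forall i, 'M[R]_(p i)) :
  (forall i, (D i)^T = D i) -> (\mxdiag_i D i)^T = \mxdiag_i D i.
Proof. by move=> symD; rewrite tr_mxdiag; apply: eq_mxdiag. Qed.

Lemma block_L_unit (R : realType) N n (M : 'I_N -> 'M[R]_n) :
  block_L M \in unitmx.
Proof.
have trigL : is_trig_mx (block_L M).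
  apply/is_trig_mxblockP; split=> [i j ltij|i]; last first.
    by rewrite eqxx scalar_mx_is_trig.
  rewrite -val_eqE /= ltn_eqF //; case: unliftP => // k ik.
  (* Here i = k + 1, so i < j excludes k = j: no block [- M k] lies above the diagonal. *)
  rewrite ik /= /bump leq0n add1n in ltij.
  by rewrite ltn_eqF // ltnW.
rewrite unitmxE det_trig // big1 ?unitr1 // => s _; rewrite /block_L !mxE eqxx.
by rewrite mxE eqxx.
Qed.

Theorem theorem8 (R : realType) (N n : nat) (p : 'I_N.+1 -> nat)
    (B : 'M[R]_n) (Q M : 'I_N -> 'M[R]_n)
    (Rb : forall i : 'I_N.+1, 'M[R]_(p i))
    (H : forall i : 'I_N.+1, 'M[R]_(p i, n))
    (hN : (1 <= N)%N) (hn : (1 <= n)%N) (hp : (1 <= \sum_(i < N.+1) p i)%N)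
    (hB : symmetric_posdef B) (hQ : forall k, symmetric_posdef (Q k))
    (hR : forall i, symmetric_posdef (Rb i)) :
  let bD := block_D B Q in
  let bR := block_R Rb in
  let bH := block_H H in
  let bL := block_L M in
  let tau_min := Num.min (eig_min bD) (eig_min bR) in
  let tau_max := Num.max (eig_max bD) (eig_max bR) in
  let theta_min := sv_min_nonzero (row_mx bL^T bH^T) in
  let theta_max := sv_max (row_mx bL^T bH^T) in
  let A1 := bL^T *m invmx bD *m bL + bH^T *m invmx bR *m bH in
  forall lambda : R, eigenvalue A1 lambda ->
    theta_min ^+ 2 / tau_max <= lambda <= theta_max ^+ 2 / tau_min.
Proof.
move=> bD bR bH bL tau_min tau_max theta_min theta_max A1 lambda.
have symD : bD^T = bD.
  by apply: sym_mxdiag => i; case: unliftP => [k|] _; [case: (hQ k) | case: hB].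
have symR : bR^T = bR by apply: sym_mxdiag => i; case: (hR i).
have Dpos a : eigenvalue bD a -> 0 < a.
  case/(@eigenvalue_mxdiag _ _ (fun=> n)
    (fun i => if unlift ord0 i is Some k then Q k else B)) => i; case: unliftP => [k|] _.
    exact: eigenvalue_posdef_gt0.
  exact: eigenvalue_posdef_gt0.
have Rpos a : eigenvalue bR a -> 0 < a.
  by case/(@eigenvalue_mxdiag _ _ p Rb) => i; apply: eigenvalue_posdef_gt0.
have m0 : (0 < \sum_(i < N.+1) n)%N by rewrite sum_nat_const card_ord muln_gt0.
(* Both D and R have positive order, so their smallest eigenvalues are attained rather than default
   values. *)
have tmin0 : 0 < tau_min by rewrite lt_min !eig_min_gt0.
pose G := row_mx bL^T bH^T.
have symG : (G *m G^T)^T = G *m G^T by rewrite trmx_mul trmxK.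
have formG (v : 'rV[R]_(\sum_(i < N.+1) n)) : (v *m (G *m G^T) *m v^T) 0 0 =
    ((v *m bL^T) *m (v *m bL^T)^T) 0 0 + ((v *m bH^T) *m (v *m bH^T)^T) 0 0.
  rewrite mulmxA -mulmxA -trmx_mul mul_mx_row tr_row_mx mul_row_col.
  by rewrite [LHS]mxE.
have Gpos a : eigenvalue (G *m G^T) a -> 0 < a.
  case/eigenvalueP=> v vG v0; have := formG v.
  rewrite vG -scalemxAl [LHS]mxE => formv.
  (* [a |v|^2] is the sum of [|vL^T|^2] and [|vH^T|^2]; the first term is positive since L is
     invertible. *)
  rewrite -(pmulr_lgt0 _ (dotself_gt0 v0)) formv ltr_wpDr ?dotself_ge0 //.
  apply: dotself_gt0; apply: contra v0 => /eqP vL0.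
  rewrite -[v](mulmxK (_ : bL^T \in unitmx)) ?unitmx_tr ?block_L_unit //.
  by rewrite vL0 mul0mx.
(* As G is at least as wide as high, its singular values are read off [G *m G^T]. *)
have mG : (\sum_(i < N.+1) n <= \sum_(i < N.+1) n + \sum_(i < N.+1) p i)%N.
  exact: leq_addr.
case/eigenvalueP=> v vA v0; have vv0 := dotself_gt0 v0.
have Gge : theta_min ^+ 2 * (v *m v^T) 0 0 <= (v *m (G *m G^T) *m v^T) 0 0.
  apply: sym_form_ge => // a eiga.
  by apply: sv_min_nonzero_sqr_le => //; apply: Gpos.
have Gle : (v *m (G *m G^T) *m v^T) 0 0 <= theta_max ^+ 2 * (v *m v^T) 0 0.
  apply: sym_form_le => // a eiga.
  by apply: sv_max_sqr_ge => //; apply/ltW/Gpos.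
have [|| Dge Dle] := andP (@invmx_form_bounds _ _ bD tau_min tau_max (v *m bL^T)
  symD Dpos tmin0 _ _); rewrite ?ge_min ?le_max ?lexx //.
have [|| Rge Rle] := andP (@invmx_form_bounds _ _ bR tau_min tau_max (v *m bH^T)
  symR Rpos tmin0 _ _); rewrite ?ge_min ?le_max ?lexx ?orbT //.
have tmax0 : 0 < tau_max.
  (* The smallest eigenvalue of D is positive and, being in the list, at most the largest. *)
  have eig_min_mem := seq_min_mem (sym_eigenvalues_neq0 symD m0).
  rewrite lt_max (lt_le_trans (eig_min_gt0 symD m0 Dpos)) //.
  exact: seq_max_ge.
have formA : lambda * (v *m v^T) 0 0 =
    (v *m bL^T *m invmx bD *m (v *m bL^T)^T) 0 0 +
    (v *m bH^T *m invmx bR *m (v *m bH^T)^T) 0 0.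
  have := congr1 (fun u => (u *m v^T) 0 0) vA.
  rewrite -scalemxAl [X in _ = X -> _]mxE => <-.
  by rewrite !trmx_mul !trmxK /A1 mulmxDr mulmxDl !mulmxA [LHS]mxE.
(* After scaling by [|v|^2], the bounds for D and R add up to [|vG|^2] over a common tau, which
   leaves [Gge] and [Gle]. *)
apply/andP; split; rewrite -(ler_pM2r vv0) formA.
  apply: le_trans (lerD Dge Rge).
  by rewrite -mulrDr -formG mulrAC mulrC ler_pM2l ?invr_gt0.
apply: le_trans (lerD Dle Rle) _.
by rewrite -mulrDr -formG mulrAC [leRHS]mulrC ler_pM2l ?invr_gt0.
Qed.
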